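(* Let $m\ge 2$ be an integer and let $P_{-4,n}(c)$, $n\ge0$, be the polynomials in $c$ defined by $P_{-4,0}=1$, $P_{-4,1}=P_{-4,2}=P_{-4,3}=0$ and $$(km+m+4)\,P_{-4,k+4}(c)=2c\,((k-1)m+2)\,P_{-4,k+2}(c)-(k-3)m\,P_{-4,k}(c),\qquad k\ge0 .$$ Then the polynomials $q_n:=P_{-4,2n+4}$, $n\ge0$, form a sequence of non-classical orthogonal polynomials.
   Context: A sequence $\{p_n\}_{n\ge0}$ of real polynomials with $\deg p_n=n$ is a sequence of orthogonal polynomials if there is a positive Borel measure $\mu$ on $\mathbb{R}$ with finite moments such that $\int p_ip_j\,d\mu=0$ for $i\ne j$ and $\int p_i^2\,d\mu>0$ for all $i$. It is called non-classical if it is not one of the classical families, i.e. it is not obtained from the Jacobi (including Gegenbauer, Legendre and Chebyshev), Laguerre or Hermite polynomials by an affine change of variable and multiplication of each polynomial by a nonzero constant. All $P_{-4,n}$ with $n$ odd vanish, as does $P_{-4,2}$. *)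

(* Defs.v *)
From mathcomp Require Import all_boot all_order all_algebra.
From mathcomp Require Import all_classical all_reals all_analysis.

Set Implicit Arguments.
Unset Strict Implicit.
Unset Printing Implicit Defensive.

Import Order.TTheory GRing.Theory Num.Theory.
Import numFieldNormedType.Exports.

Local Open Scope classical_set_scope.
Local Open Scope ring_scope.

Definition orthogonal_polynomials (R : realType) (p : nat -> {poly R}) : Prop :=
  (forall n, size (p n) = n.+1) /\
  exists mu : {measure set (measurableTypeR R) -> \bar R},
    [/\ forall n, mu.-integrable setT (fun x : measurableTypeR R => (x ^+ n)%:E),
        forall i j, i <> j ->
          (\int[mu]_(x in setT) ((p i).[x] * (p j).[x])%:E = 0)%E
      & forall i, (0 < \int[mu]_(x in setT) ((p i).[x] ^+ 2)%:E)%E ].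

(* generalized binomial coefficient: a (a - 1) ... (a - k + 1) / k! *)
Definition gbinom (R : realType) (a : R) (k : nat) : R :=
  (\prod_(i < k) (a - i%:R)) / k`!%:R.

(* DLMF 18.5.8 *)
Definition jacobi (R : realType) (a b : R) (n : nat) : {poly R} :=
  \sum_(s < n.+1) (gbinom (n%:R + a) s * gbinom (n%:R + b) (n - s) / 2 ^+ n) *:
    (('X - 1) ^+ (n - s) * ('X + 1) ^+ s).

(* DLMF 18.5.12 *)
Definition laguerre (R : realType) (a : R) (n : nat) : {poly R} :=
  \poly_(s < n.+1) ((-1) ^+ s * gbinom (n%:R + a) (n - s) / s`!%:R).

(* Physicists' normalization, DLMF 18.5.13 *)
Definition hermite (R : realType) (n : nat) : {poly R} :=
  \sum_(s < n./2.+1)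
    ((-1) ^+ s * n`!%:R / (s`!%:R * (n - 2 * s)`!%:R)) *:
      (2 *: 'X) ^+ (n - 2 * s).

Definition affine_rescaling (R : realType) (p r : nat -> {poly R}) : Prop :=
  exists a b : R, a != 0 /\
  exists c : nat -> R, forall n,
    c n != 0 /\ p n = c n *: (r n \Po (a *: 'X + b%:P)).

(* The Gegenbauer, Legendre and Chebyshev polynomials are, up to nonzero
   constants depending on n, Jacobi polynomials with parameters in the range
   below, so they need no separate clause. *)
Definition classical_polynomials (R : realType) (p : nat -> {poly R}) : Prop :=
  [\/ exists a b : R,
        [/\ -1 < a, -1 < b & affine_rescaling p (jacobi a b)],
      exists2 a : R, -1 < a & affine_rescaling p (laguerre a)
    | affine_rescaling p (@hermite R) ].

(* Main.v *)
(* Up to normalization, [q n] satisfies a three-term recurrence whose monic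
   form is [x p_n = p_(n+1) + lambda_n p_(n-1)] with [0 < lambda_n <= 1/4].

   Orthogonality (Favard's theorem for such [lambda]): the truncated symmetric
   Jacobi matrices [J] with off-diagonal entries [sqrt lambda_n] satisfy
   [-1 <= J <= 1], and [q_i(J)] maps the first basis vector to a multiple of
   the [i]-th one. Hence [p |-> (p(J))_00] is nonnegative on the polynomials
   [(1 + x)^i (1 - x)^j], and eventually takes the values required on
   [q_i * q_j]. Hausdorff's solution of the moment problem on an interval,
   by Bernstein polynomials, then yields the measure.

   Non-classicality: the degrees up to 4 suffice. An affine rescaling of Jacobi
   polynomials with the symmetry of [q] has [a = b], and then
   [lambda_3 (5 lambda_1 - lambda_2) = (lambda_1 + lambda_2)^2], which fails
   here; Hermite polynomials would need [lambda_2 = 2 lambda_1], and Laguerre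
   polynomials do not have the right parity. *)
From HB Require Import structures.
Require Import Defs.
From mathcomp Require Import all_boot all_order all_algebra.
From mathcomp Require Import all_classical all_reals all_analysis.
From mathcomp Require Import measurable_realfun ring lra zify.

Set Implicit Arguments.
Unset Strict Implicit.
Unset Printing Implicit Defensive.

Import Order.TTheory GRing.Theory Num.Theory.
Import numFieldNormedType.Exports.

Local Open Scope classical_set_scope.
Local Open Scope ring_scope.

(** * Riemann sums and quantile functions *)

Lemma nondecreasing_integrable (R : realType) (g : R -> R) (a b : R) :
  {homo g : x y / x <= y} ->
  (@lebesgue_measure R).-integrable `]a, b] (EFin \o g).
Proof.
move=> gm; have mI : measurable `]a, b] by exact: measurable_itv.
apply: measurable_bounded_integrable => //.
- rewrite /= lebesgue_measure_itv /=; case: ifP => _; last exact: ltry.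
  by rewrite -EFinB ltry.
- exact: nondecreasing_measurable.
exists (Num.max `|g a| `|g b|); split; first exact: num_real.
move=> M hM x /=; rewrite in_itv /= => /andP[ax xb].
apply: le_trans (ltW hM).
have := gm _ _ (ltW ax); have := gm _ _ xb.
rewrite le_max => h1 h2; have [g0|g0] := leP 0 (g x).
  by rewrite [`|g x|]ger0_norm// (le_trans h1 (ler_norm _)) orbT.
by rewrite [`|g x|]ltr0_norm// [`|g a|]ler0_norm ?lerN2 ?h2// (le_trans h2)// ltW.
Qed.

Lemma Rintegral_itv_cst (R : realType) (a b c : R) : a <= b ->
  \int[@lebesgue_measure R]_(u in `]a, b]) c = (b - a) * c.
Proof.
move=> ab; rewrite Rintegral_cst//= lebesgue_measure_itv /= mulrC.
move: ab; rewrite le_eqVlt lte_fin => /predU1P[->|->].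
  by rewrite ltxx subrr.
by rewrite -EFinB.
Qed.

Lemma Rintegral_nondecreasing_bounds (R : realType) (g : R -> R) (a b : R) :
  {homo g : x y / x <= y} -> a <= b ->
  (b - a) * g a <= \int[@lebesgue_measure R]_(u in `]a, b]) g u
               <= (b - a) * g b.
Proof.
move=> gm ab.
rewrite -!(Rintegral_itv_cst _ ab); have ig := nondecreasing_integrable a b gm.
have icst c : (@lebesgue_measure R).-integrable `]a, b] (EFin \o cst c).
  by apply: nondecreasing_integrable.
apply/andP; split; apply: le_Rintegral => //=.
- exact: icst.
- by move=> x; rewrite in_itv /= => /andP[/ltW/gm].
- exact: icst.
- by move=> x; rewrite in_itv /= => /andP[_ /gm].
Qed.

(** The left and right Riemann sums enclose the integral and differ by [(g 1 - g 0) / K.+1%:R],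
    which is at most the mesh; the bound is thus uniform in [g]. *)
Lemma Rintegral_nondecreasing_riemann (R : realType) (g : R -> R) (K : nat) :
  {homo g : x y / x <= y} -> (forall x, 0 <= g x <= 1) ->
  `|\int[@lebesgue_measure R]_(u in `]0, 1]) g u
    - (\sum_(i < K.+1) g (i%:R / K.+1%:R)) / K.+1%:R| <= K.+1%:R^-1.
Proof.
move=> gm g01; set c : R := K.+1%:R^-1.
have c0 : 0 < c by rewrite invr_gt0.
have bnd (j : nat) : c * (\sum_(i < j) g (i%:R * c))
    <= \int[@lebesgue_measure R]_(u in `]0, j%:R * c]) g u
    <= c * (\sum_(i < j) g (i.+1%:R * c)).
  elim: j => [|j IH].
    by rewrite !big_ord0 mul0r set_itv_ge ?bnd_simp ?ltxx// Rintegral_set0 mulr0 lexx.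
  have le1 : 0 <= j%:R * c by rewrite mulr_ge0// ltW.
  have le2 : j%:R * c <= j.+1%:R * c by rewrite ler_pM2r// ler_nat.
  have := @Rintegral_itvB _ g (BRight 0) (BRight (j.+1%:R * c)) (j%:R * c).
  rewrite !bnd_simp => /(_ (nondecreasing_integrable _ _ gm) le1 le2).
  have := Rintegral_nondecreasing_bounds gm le2.
  rewrite -mulrBl -natrB// subSnn mul1r => b2 e.
  by rewrite !big_ord_recr /= !mulrDr; move: IH b2; rewrite -e; lra.
have := bnd K.+1; rewrite /c divff ?pnatr_eq0// -/c.
rewrite [X in _ <= _ <= c * X]big_ord_recr /= [X in X <= _ <= _]mulrC.
have -> : \sum_(i < K) g (i.+1%:R * c) = \sum_(i < K.+1) g (i%:R * c) - g 0.
  by rewrite [in RHS]big_ord_recl /= mul0r addrAC subrr add0r.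
set I := Rintegral _ _ _; set S := \sum_(i < _) _.
move=> /andP[h1 h2].
have hS : c * (S - g 0 + g (K.+1%:R * c)) <= c * (S + 1).
  have /andP[g0 _] := g01 0; have /andP[_ g1] := g01 (K.+1%:R * c).
  by rewrite ler_pM2l//; lra.
by rewrite [S * c]mulrC ler_norml; apply/andP; split; lra.
Qed.

Lemma Rintegral_sum d (T : measurableType d) (R : realType)
    (mu : {measure set T -> \bar R}) (D : set T) (F : nat -> T -> R) (n : nat) :
  measurable D -> (forall i, mu.-integrable D (EFin \o F i)) ->
  mu.-integrable D (EFin \o (fun x => \sum_(i < n) F i x)) /\
  \int[mu]_(x in D) (\sum_(i < n) F i x) = \sum_(i < n) \int[mu]_(x in D) F i x.
Proof.
move=> mD iF; elim: n => [|n [iS IH]].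
  rewrite big_ord0.
  under [X in EFin \o X]eq_fun do rewrite big_ord0.
  under eq_Rintegral do rewrite big_ord0.
  by split; [exact: integrable0|rewrite Rintegral_cst// mul0r].
under [X in EFin \o X]eq_fun do rewrite big_ord_recr.
under eq_Rintegral do rewrite big_ord_recr.
rewrite big_ord_recr /= -IH -RintegralD//; split => //.
exact: (integrableD mD iS (iF n)).
Qed.

Lemma Rintegral_step (R : realType) (s : R) : 0 <= s <= 1 ->
  \int[@lebesgue_measure R]_(u in `]0, 1]) (s < u)%R%:R = 1 - s.
Proof.
move=> /andP[s0 s1].
have st : {homo (fun u : R => (s < u)%R%:R : R) : x y / x <= y}.
  move=> x y xy; case: (ltrP s x) => [sx|_]; last exact: ler0n.
  by rewrite (lt_le_trans sx xy).
have := @Rintegral_itvB R (fun u => (s < u)%R%:R) (BRight 0) (BRight 1) s.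
rewrite !bnd_simp => /(_ (nondecreasing_integrable _ _ st) s0 s1).
rewrite [X in _ - X](@eq_Rintegral _ _ _ _ _ (fun=> 0)); last first.
  by move=> x; rewrite inE /= in_itv /= => /andP[_ xs]; rewrite ltNge xs.
rewrite [RHS](@eq_Rintegral _ _ _ _ _ (fun=> 1)); last first.
  by move=> x; rewrite inE /= in_itv /= => /andP[->].
by rewrite !Rintegral_itv_cst// mulr0 subr0 mulr1.
Qed.

(* The generalized inverse, on the grid {0, ..., N}, of the distribution
   function of the weights [w]. *)
Definition quantile (R : realType) (w : nat -> R) (N : nat) (u : R) : nat :=
  \sum_(k < N) (\sum_(j < k.+1) w j < u)%R.

Lemma quantile_le (R : realType) (w : nat -> R) (N : nat) (u : R) :
  (quantile w N u <= N)%N.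
Proof.
rewrite -[leqRHS]card_ord -sum1_card; apply: leq_sum => i _.
by case: (_ < _).
Qed.

Lemma quantile_homo (R : realType) (w : nat -> R) (N : nat) (u v : R) :
  u <= v -> (quantile w N u <= quantile w N v)%N.
Proof.
move=> uv; apply: leq_sum => i _; case: (ltrP _ u) => // h.
by rewrite (lt_le_trans h uv).
Qed.

Lemma ler_partial_sum (R : realType) (w : nat -> R) (k n : nat) :
  (forall k, 0 <= w k) -> (k <= n)%N -> \sum_(j < k) w j <= \sum_(j < n) w j.
Proof.
by move=> w0 kn; rewrite -(subnKC kn) big_split_ord /= lerDl sumr_ge0.
Qed.

(** Partial sums of nonnegative weights increase, so the indicators equal to 1 are exactly those
    with [k < quantile w N u], and the increments of [f] telescope. This turns a function of the
    quantile into a combination of step functions in [u]. *)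
Lemma fun_quantile (R : realType) (w f : nat -> R) (N : nat) (u : R) :
  (forall k, 0 <= w k) ->
  f (quantile w N u) = f 0%N +
    \sum_(k < N) (f k.+1 - f k) * (\sum_(j < k.+1) w j < u)%R%:R.
Proof.
move=> w0; elim: N => [|N IH]; first by rewrite /quantile !big_ord0 addr0.
rewrite big_ord_recr /= addrA -IH {1}/quantile big_ord_recr /= -/(quantile w N u).
case: ltrP => [lt|_]; last by rewrite addn0 mulr0 addr0.
suff -> : quantile w N u = N by rewrite addn1 mulr1 addrC subrK.
rewrite -[RHS]card_ord -sum1_card; apply: eq_bigr => i _.
by rewrite (le_lt_trans _ lt)// ler_partial_sum// ltnS ltnW.
Qed.

Lemma abel_sum (R : realType) (w f : nat -> R) (N : nat) :
  \sum_(k < N.+1) w k * f k = f 0%N * (\sum_(k < N.+1) w k) +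
    \sum_(k < N) (f k.+1 - f k)
      * (\sum_(j < N.+1) w j - \sum_(j < k.+1) w j).
Proof.
elim: N => [|N IH]; first by rewrite !big_ord_recr !big_ord0 /=; ring.
rewrite big_ord_recr /= IH [X in _ = _ + X]big_ord_recr /=.
have -> : \sum_(j < N.+2) w j = \sum_(j < N.+1) w j + w N.+1.
  by rewrite big_ord_recr.
under [X in _ = _ + (X + _)]eq_bigr do rewrite addrAC mulrDr.
rewrite big_split /= -mulr_suml.
have -> : \sum_(i < N) (f i.+1 - f i) = f N - f 0%N.
  by rewrite -(big_mkord xpredT (fun i => f i.+1 - f i)) telescope_sumr.
ring.
Qed.

(** The quantile function pushes the uniform measure to the weights [w]: each step function of
    [fun_quantile] integrates to a tail of [w], and summation by parts reassembles the tails. *)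
Lemma Rintegral_quantile (R : realType) (w f : nat -> R) (N : nat) :
  (forall k, 0 <= w k) -> \sum_(k < N.+1) w k = 1 ->
  \int[@lebesgue_measure R]_(u in `]0, 1]) f (quantile w N u)
    = \sum_(k < N.+1) w k * f k.
Proof.
move=> w0 w1; rewrite abel_sum w1 mulr1.
under eq_Rintegral do rewrite fun_quantile//.
have st k : {homo (fun u : R => (\sum_(j < k.+1) w j < u)%R%:R : R) : x y / x <= y}.
  move=> x y xy; case: (ltrP _ x) => [sx|_]; last exact: ler0n.
  by rewrite (lt_le_trans sx xy).
have mI : measurable (`]0, 1] : set (measurableTypeR R)) by exact: measurable_itv.
have iF k := integrableZl mI (f k.+1 - f k) (nondecreasing_integrable 0 1 (st k)).
have [iS eS] := Rintegral_sum N mI iF.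
rewrite RintegralD//; last by apply: (@nondecreasing_integrable _ (cst (f 0%N))).
rewrite Rintegral_itv_cst ?ler01// subr0 mul1r; congr (_ + _).
rewrite eS; apply: eq_bigr => k _.
rewrite RintegralZl//; last exact: nondecreasing_integrable.
rewrite Rintegral_step// sumr_ge0//= -w1.
by rewrite ler_partial_sum// ltnS ltnW.
Qed.

(** * Bernstein moments *)

Lemma ffact_le_expn (k n : nat) : (k ^_ n <= k ^ n)%N.
Proof.
elim: n => [|n IH]; first by rewrite ffactn0.
by rewrite ffactnSr expnSr leq_mul// leq_subr.
Qed.

(** Replacing a power by a falling factorial costs a relative error of order [1/N]. The step from
    [n] to [n.+1] adds at most [n * N ^ n.+1], and [n ^ 2 + n <= n.+1 ^ 2]. *)
Lemma leq_expn_ffact (k N n : nat) : (k <= N)%N ->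
  (N * k ^ n <= N * k ^_ n + n ^ 2 * N ^ n)%N.
Proof.
move=> kN; elim: n => [|n IH]; first by rewrite leq_addr.
have fN : (k ^_ n <= N ^ n)%N.
  apply: leq_trans (ffact_le_expn _ _) _.
  by case: (n) => // n'; rewrite leq_exp2r.
rewrite ffactnSr expnS [(N ^ n.+1)%N]expnS.
(* Only an inequality, because the subtraction is truncated when [k < n]. *)
have kn : (k <= (k - n) + n)%N by lia.
have h1 := leq_mul (leqnn k) IH.
have h2 := leq_mul (leqnn N) (leq_mul kn (leqnn (k ^_ n))).
have h3 := leq_mul (leqnn (N * n)) fN.
have h4 := leq_mul (leqnn (n ^ 2)) (leq_mul kN (leqnn (N ^ n))).
rewrite !expnS expn0 in h1 h4 *; nia.
Qed.

(** Both sides count the choices of [n] ordered and [j] further unordered elements among [N]. *)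
Lemma mul_bin_ffact (N n j : nat) : (n + j <= N)%N ->
  ('C(N, n + j) * (n + j) ^_ n = N ^_ n * 'C(N - n, j))%N.
Proof.
move=> h; have nN : (n <= N)%N by apply: leq_trans h; exact: leq_addr.
have jN : (j <= N - n)%N by rewrite leq_subRL.
apply/eqP; rewrite -(eqn_pmul2r (_ : 0 < j`! * (N - n - j)`!)%N); last first.
  by rewrite muln_gt0 !fact_gt0.
rewrite -[X in _ == X]mulnA bin_fact// ffact_fact// -(bin_fact h).
have -> : ((n + j)`! = (n + j) ^_ n * j`!)%N.
  by rewrite -(ffact_fact (leq_addr j n)) addKn.
by rewrite subnDA !mulnA.
Qed.

Section Bernstein.
Variable R : realType.

Definition bernstein (N k : nat) : {poly R} :=
  'C(N, k)%:R *: ('X^k * (1 - 'X) ^+ (N - k)).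

(** These are the factorial moments of the binomial distribution. The terms with [k < n] vanish, and
    the others form the expansion of [((1 - 'X) + 'X) ^+ (N - n)]. *)
Lemma sum_ffact_bernstein (N n : nat) :
  \sum_(k < N.+1) (k ^_ n)%:R *: bernstein N k = (N ^_ n)%:R *: 'X^n.
Proof.
have [nN|Nn] := leqP n N; last first.
  rewrite ffact_small// scale0r big1// => k _.
  by rewrite ffact_small ?scale0r// (leq_trans (ltn_ord k)).
have -> : N.+1 = (n + (N - n).+1)%N by rewrite addnS subnKC.
rewrite big_split_ord /= big1 ?add0r => [|k _]; last first.
  by rewrite ffact_small ?scale0r.
transitivity ((N ^_ n)%:R *: ('X^n * ((1 - 'X) + 'X : {poly R}) ^+ (N - n))).
  rewrite exprDn mulr_sumr scaler_sumr; apply: eq_bigr => j _.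
  have jN : (n + j <= N)%N by have := ltn_ord j; lia.
  rewrite /bernstein scalerA -natrM mulnC mul_bin_ffact// natrM -scalerA.
  congr (_ *: _); rewrite -[in RHS]scaler_nat -scalerAr exprD subnDA.
  by congr (_ *: _); rewrite -mulrA; congr (_ * _); exact: mulrC.
by rewrite subrK expr1n mulr1.
Qed.

Variable L : {scalar {poly R}}.
Hypothesis L1 : L 1 = 1.
Hypothesis L_ge0 : forall i j, 0 <= L ('X^i * (1 - 'X) ^+ j).

Lemma bernstein_ge0 N k : 0 <= L (bernstein N k).
Proof. by rewrite linearZ mulr_ge0. Qed.

Lemma bernstein_sum1 N : \sum_(k < N.+1) L (bernstein N k) = 1.
Proof.
have := congr1 L (sum_ffact_bernstein N 0).
rewrite !ffactn0 scale1r expr0 L1 => <-; rewrite linear_sum.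
by apply: eq_bigr => k _; rewrite ffactn0 scale1r.
Qed.

Lemma moment_itv n : 0 <= L 'X^n <= 1.
Proof.
have := L_ge0 n 0; rewrite expr0 mulr1 => -> /=.
have : 0 <= L (1 - 'X^n).
  (* The factorization of [1 - 'X^n] by [1 - 'X] leaves a sum of powers of ['X], so [L_ge0] applies
     termwise. *)
  rewrite -opprB subrX1 -mulNr opprB mulr_sumr linear_sum sumr_ge0// => i _.
  by rewrite mulrC -[1 - 'X]expr1.
by rewrite linearB L1 subr_ge0.
Qed.

(** Factorial moments are exact up to the factor [N.+1 ^_ n / N.+1 ^ n]. Passing from powers to
    falling factorials under the sum, and from this factor to 1, each costs at most
    [n ^ 2 / N.+1]. *)
Lemma bernstein_moment N n :
  `|\sum_(k < N.+2) L (bernstein N.+1 k) * (k%:R / N.+1%:R) ^+ n - L 'X^n|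
    <= (2 * n ^ 2)%:R / N.+1%:R.
Proof.
set M := N.+1; have M0 : 0 < M%:R :> R by rewrite ltr0n.
have Mn0 : 0 < M%:R ^+ n :> R by rewrite exprn_gt0.
have key k : (k <= M)%N ->
    0 <= (k%:R / M%:R : R) ^+ n - (k ^_ n)%:R / M%:R ^+ n <= (n ^ 2)%:R / M%:R.
  move=> kM; rewrite expr_div_n -mulrBl; apply/andP; split.
    by rewrite divr_ge0 ?(ltW Mn0)// subr_ge0 -natrX ler_nat ffact_le_expn.
  rewrite ler_pdivrMr// mulrAC ler_pdivlMr// mulrC.
  have := leq_expn_ffact n kM; rewrite -(ler_nat R) natrD !natrM !natrX.
  lra.
set S := \sum_(k < _) _.
have eF : \sum_(k < M.+1) L (bernstein M k) * ((k ^_ n)%:R / M%:R ^+ n)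
    = (M ^_ n)%:R / M%:R ^+ n * L 'X^n.
  have := congr1 L (sum_ffact_bernstein M n).
  rewrite linear_sum linearZ /= => e.
  rewrite mulrAC -e mulr_suml; apply: eq_bigr => k _.
  by rewrite [in RHS]linearZ /= [in LHS]mulrA [X in X / _ = _]mulrC.
have b1 : 0 <= S - (M ^_ n)%:R / M%:R ^+ n * L 'X^n <= (n ^ 2)%:R / M%:R.
  rewrite -eF -sumrB; under eq_bigr do rewrite -mulrBr.
  apply/andP; split.
    apply: sumr_ge0 => k _; rewrite mulr_ge0 ?bernstein_ge0//.
    by have /andP[] := key k (ltn_ord k).
  have -> : (n ^ 2)%:R / M%:R =
      \sum_(k < M.+1) L (bernstein M k) * ((n ^ 2)%:R / M%:R).
    by rewrite -mulr_suml bernstein_sum1 mul1r.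
  apply: ler_sum => k _.
  rewrite ler_wpM2l ?bernstein_ge0//.
  by have /andP[] := key k (ltn_ord k).
(* At [k = M] the power is 1, so [key] also compares the factor [M ^_ n / M ^ n] with 1. *)
have := key M (leqnn M); rewrite divff ?gt_eqF// expr1n.
have /andP[] := moment_itv n.
move: b1; rewrite natrM; set a := _ / _ ^+ n; set b := _ / M%:R; set l := L 'X^n.
move=> /andP[h1 h2] l0 l1 /andP[h3 h4].
have -> : 2%:R * (n ^ 2)%:R / M%:R = 2 * b by rewrite /b mulrA.
by rewrite ler_norml; apply/andP; split; nra.
Qed.

End Bernstein.

(** * Hausdorff's moment problem *)

(** Compactness of the interval gives a cluster point, and an ultrafilter converges to its cluster
    points. *)
Lemma ultra_itv_limit (R : realType) (U : set_system nat) (f : nat -> R) :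
  UltraFilter U -> (forall N, 0 <= f N <= 1) ->
  exists2 l : R, 0 <= l <= 1 & f @ U --> l.
Proof.
move=> UU f01; have PU : ProperFilter U by exact: ultra_proper.
have [|l [l01 fl]] := @segment_compact R 0 1 (f @ U) _.
  by apply: (@filterE _ U) => N; rewrite /= in_itv /=; exact: f01.
exists l; first by move: l01; rewrite /= in_itv.
move=> A lA; have [//|nA] := in_ultra_setVsetC (f @^-1` A) UU.
by have [x [nAx /nAx]] := fl (~` A) A nA lA.
Qed.

Lemma nondecreasing_itv_integrable_horner (R : realType) (Q : R -> R)
    (p : {poly R}) :
  {homo Q : x y / x <= y} -> (forall u, 0 <= Q u <= 1) ->
  (@lebesgue_measure R).-integrable `]0, 1] (EFin \o (fun u => p.[Q u])) /\
  \int[@lebesgue_measure R]_(u in `]0, 1]) p.[Q u]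
   = \sum_(i < size p) p`_i * \int[@lebesgue_measure R]_(u in `]0, 1]) Q u ^+ i.
Proof.
move=> Qm Q01.
have mI : measurable (`]0, 1] : set (measurableTypeR R)) by exact: measurable_itv.
have Qim i : {homo (fun u => Q u ^+ i) : x y / x <= y}.
  move=> x y /Qm xy; apply: lerXn2r => //; rewrite nnegrE.
    by have /andP[] := Q01 x.
  by have /andP[] := Q01 y.
have iQ i := integrableZl mI (p`_i) (nondecreasing_integrable 0 1 (Qim i)).
have [iS eS] := Rintegral_sum (size p) mI iQ.
have e : (fun u => p.[Q u]) = (fun u => \sum_(i < size p) p`_i * Q u ^+ i).
  by apply/funext => u; rewrite horner_coef.
rewrite e; split => //; rewrite eS; apply: eq_bigr => i _.
by rewrite RintegralZl//; exact: nondecreasing_integrable.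
Qed.

(* The functionals [L N] need only converge: their representing measures are
   constructed at level [N] as the push-forward of the uniform measure by the
   quantile function of the Bernstein weights, and the quantile functions
   converge pointwise along an ultrafilter. Riemann sums of a monotone function
   converge at a rate independent of the function, so this suffices for the
   convergence of the integrals. *)
Theorem hausdorff_moment (R : realType) (L : nat -> {scalar {poly R}}) :
  (forall N, L N 1 = 1) ->
  (forall N i j, 0 <= L N ('X^i * (1 - 'X) ^+ j)) ->
  exists Q : R -> R, [/\ {homo Q : x y / x <= y}, forall u, 0 <= Q u <= 1 &
    forall (p : {poly R}) l, L N p @[N --> \oo] --> l ->
      \int[@lebesgue_measure R]_(u in `]0, 1]) p.[Q u] = l].
Proof.
move=> L1 L_ge0.
have [U [UU sU]] := ultraFilterLemma (@eventually_filter).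
pose w N k := L N (bernstein R N k).
have w_ge0 N k : 0 <= w N k by apply: bernstein_ge0 => i j; exact: L_ge0.
pose QN N u : R := (quantile (w N) N u)%:R / N%:R.
have QN01 u N : 0 <= QN N u <= 1.
  apply/andP; split; first by rewrite divr_ge0.
  (* At [N = 0] the convention [0^-1 = 0] makes the value 0. *)
  case: N => [|N]; first by rewrite /QN invr0 mulr0.
  by rewrite ler_pdivrMr ?mul1r ?ler_nat ?quantile_le.
have QNm N : {homo QN N : x y / x <= y}.
  by move=> x y xy; rewrite ler_wpM2r ?invr_ge0// ler_nat quantile_homo.
have /choice[Q QP] : forall u, exists l : R, 0 <= l <= 1 /\ QN^~ u @ U --> l.
  by move=> u; have [l] := ultra_itv_limit UU (QN01 u); exists l.
have Q01 u : 0 <= Q u <= 1 by have [] := QP u.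
have QU u : QN^~ u @ U --> Q u by have [] := QP u.
have Qm : {homo Q : x y / x <= y}.
  move=> x y xy; apply: (ler_cvg_to (QU x) (QU y)).
  by apply: nearW => N; exact: QNm.
exists Q; split => // p l Lp.
have expm (g : R -> R) i : {homo g : x y / x <= y} -> (forall u, 0 <= g u <= 1) ->
    {homo (fun u => g u ^+ i) : x y / x <= y} /\ forall u, 0 <= g u ^+ i <= 1.
  move=> gm g01; split=> [x y /gm xy|u]; last first.
    by have /andP[g0 g1] := g01 u; rewrite exprn_ge0// exprn_ile1.
  apply: lerXn2r => //; rewrite nnegrE.
    by have /andP[] := g01 x.
  by have /andP[] := g01 y.
(* Four errors of [e / 4]: Riemann sums for [Q] and for [QN N] on one grid, pointwise convergence at
   the finitely many grid points, and the Bernstein estimate. The grid is fixed before [N], as the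
   Riemann error is uniform. *)
have LQ i : L N 'X^i @[N --> U]
    --> \int[@lebesgue_measure R]_(u in `]0, 1]) Q u ^+ i.
  apply/cvgrPdist_le => e e0.
  have e4 : 0 < e / 4 by rewrite divr_gt0.
  have [K hK] : exists K : nat, K.+1%:R^-1 <= e / 4.
    by have [K] := ltr_add_invr e4; rewrite add0r => /ltW; exists K.
  pose T (g : R -> R) := (\sum_(j < K.+1) g (j%:R / K.+1%:R) ^+ i) / K.+1%:R.
  have TU : T (QN N) @[N --> U] --> T Q.
    apply: cvgM; last exact: cvg_cst.
    apply: cvg_big => [|j _]; first exact: add_continuous.
    exact: (cvg_comp _ _ (QU _) (@exprn_continuous R i _)).
  have hT (g : R -> R) : {homo g : x y / x <= y} -> (forall u, 0 <= g u <= 1) ->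
      `|\int[@lebesgue_measure R]_(u in `]0, 1]) g u ^+ i - T g| <= e / 4.
    move=> gm g01; have [gim gi01] := expm g i gm g01.
    exact: le_trans (Rintegral_nondecreasing_riemann K gim gi01) hK.
  have nN : \forall N \near U, `|\int[@lebesgue_measure R]_(u in `]0, 1])
      QN N u ^+ i - L N 'X^i| <= e / 4.
    apply: sU; near=> N.
    have [M NM] : exists M, N = M.+1.
      by exists N.-1; rewrite prednK//; near: N; exact: nbhs_infty_gt.
    rewrite NM (Rintegral_quantile (fun k => (k%:R / M.+1%:R) ^+ i))//; last first.
      exact: bernstein_sum1.
    apply: le_trans (bernstein_moment (L1 _) (L_ge0 _) M i) _.
    rewrite ler_pdivrMr ?ltr0n// mulrC -ler_pdivrMr// -NM.
    by near: N; exact: nbhs_infty_ger.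
  have nT : \forall N \near U, `|T Q - T (QN N)| <= e / 4.
    by move/cvgrPdist_le : TU; exact.
  near=> N; have h1 := hT Q Qm Q01; have h2 := hT (QN N) (QNm N) (QN01 ^~ N).
  have h3 : `|\int[@lebesgue_measure R]_(u in `]0, 1])
      QN N u ^+ i - L N 'X^i| <= e / 4 by near: N.
  have h4 : `|T Q - T (QN N)| <= e / 4 by near: N.
  move: h1 h2 h3 h4; rewrite !ler_norml.
  move=> /andP[? ?] /andP[? ?] /andP[? ?] /andP[? ?].
  by apply/andP; split; lra.
have LpU : L N p @[N --> U]
    --> \int[@lebesgue_measure R]_(u in `]0, 1]) p.[Q u].
  have [_ ->] := nondecreasing_itv_integrable_horner p Qm Q01.
  have -> : (fun N => L N p) = (fun N => \sum_(i < size p) p`_i * L N 'X^i).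
    apply/funext => N; rewrite -[in LHS](coefK p) poly_def linear_sum.
    by apply: eq_bigr => i _; rewrite linearZ.
  apply: cvg_big => [|i _]; first exact: add_continuous.
  apply: cvgM; [exact: cvg_cst|exact: LQ].
have PU : ProperFilter U by exact: ultra_proper.
apply: (@cvg_unique _ _ (L N p @[N --> U])) => //.
by apply: cvg_trans Lp => A /sU.
Unshelve. all: by end_near. Qed.

(** The formula for nonnegative integrands is applied to the positive and negative parts; dropping
    the endpoint 0 does not change the integrals. *)
Lemma integral_uniform01 (R : realType) (f : measurableTypeR R -> \bar R) :
  measurable_fun setT f ->
  (\int[uniform_prob (@ltr01 R)]_x f x = \int[@lebesgue_measure R]_(x in `]0%R, 1%R]) f x)%E.
Proof.
move=> mf; rewrite integralE [RHS]integralE.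
have key g : measurable_fun setT g -> (forall x, 0 <= g x)%E ->
    (\int[uniform_prob (@ltr01 R)]_x g x
      = \int[@lebesgue_measure R]_(x in `]0%R, 1%R]) g x)%E.
  move=> mg g0; rewrite integral_uniform// subr0 invr1 mul1e.
  by rewrite integral_itv_obnd_cbnd//; exact: measurable_funTS.
rewrite !key//; [exact: measurable_funeneg|exact: measurable_funepos].
Qed.

Lemma horner_itv_bounded (R : realType) (p : {poly R}) :
  exists M : R, forall x, `|x| <= 1 -> `|p.[x]| <= M.
Proof.
exists (\sum_(i < size p) `|p`_i|) => x x1; rewrite horner_coef.
apply: le_trans (ler_norm_sum _ _ _) _; apply: ler_sum => i _.
by rewrite normrM normrX ler_piMr// exprn_ile1.
Qed.

(** The measure is the image of the uniform one under [2 * Q u - 1], which carries the problem from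
    [[0, 1]] back to [[-1, 1]]. Polynomials are integrable because they are bounded there. *)
Lemma horner_integral_quantile_measure (R : realType) (Q : R -> R) :
  {homo Q : x y / x <= y} -> (forall u, 0 <= Q u <= 1) ->
  exists mu : {measure set (measurableTypeR R) -> \bar R}, forall p : {poly R},
    mu.-integrable setT (fun x : measurableTypeR R => p.[x]%:E) /\
    (\int[mu]_x p.[x]%:E = (\int[@lebesgue_measure R]_(u in `]0%R, 1%R])
       (p \Po (2 *: 'X - 1)).[Q u])%:E)%E.
Proof.
move=> Qm Q01; pose phi (u : measurableTypeR R) : measurableTypeR R := 2 * Q u - 1.
have phim : {homo phi : x y / (x : R) <= y}.
  by move=> x y /Qm xy; rewrite /phi; lra.
have phi1 u : `|phi u| <= 1.
  by have /andP[? ?] := Q01 u; rewrite /phi ler_norml; apply/andP; split; lra.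
have mphi : measurable_fun setT phi by exact: nondecreasing_measurable.
pose mu : {measure set (measurableTypeR R) -> \bar R} :=
  pushforward (uniform_prob (@ltr01 R)) phi.
exists (mu mphi) => p.
have mp : measurable_fun setT (fun x : measurableTypeR R => p.[x]).
  apply: continuous_measurable_fun; exact: continuous_horner.
have mEp : measurable_fun setT (fun x : measurableTypeR R => p.[x]%:E).
  exact/measurable_EFinP.
have ip : (uniform_prob (@ltr01 R)).-integrable setT (fun u => p.[phi u]%:E).
  apply: measurable_bounded_integrable => //.
  - have : (uniform_prob (@ltr01 R) setT < +oo)%E by rewrite probability_setT ltry.
    exact.
  - exact: measurableT_comp.
  have [M hM] := horner_itv_bounded p.
  exists M; split; first exact: num_real.
  by move=> M' MM' u _; apply: le_trans (ltW MM'); exact: hM.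
split; first exact: integrable_pushforward.
rewrite integral_pushforward//= preimage_setT integral_uniform01; last first.
  by case/integrableP : ip.
have [iq _] := nondecreasing_itv_integrable_horner (p \Po (2 *: 'X - 1)) Qm Q01.
rewrite /Rintegral fineK; last exact: integrable_fin_num.
apply: eq_integral => u _ /=.
by rewrite horner_comp !hornerE.
Qed.

(** * Symmetric contractions *)

Section SymmetricContraction.
Variables (R : realType) (n : nat).
Implicit Types (A B : 'M[R]_n.+1) (p q : {poly R}) (v : 'rV[R]_n.+1).

Definition mx_psd B := forall v, 0 <= (v *m B *m v^T) 0 0.

Lemma horner_mx_comp A p q : horner_mx A (p \Po q) = horner_mx (horner_mx A q) p.
Proof.
elim/poly_ind: p => [|p c IH]; first by rewrite comp_poly0 !rmorph0.
by rewrite comp_poly_MXaddC !rmorphD !rmorphM /= IH horner_mx_X !horner_mx_C.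
Qed.

Lemma trmx_horner_mx A p : A^T = A -> (horner_mx A p)^T = horner_mx A p.
Proof.
move=> symA; elim/poly_ind: p => [|p c IH]; first by rewrite rmorph0 trmx0.
rewrite rmorphD rmorphM /= horner_mx_X horner_mx_C linearD /= tr_scalar_mx.
rewrite trmx_mul IH symA; congr (_ + _).
have : GRing.comm (horner_mx A p) A by exact: comm_horner_mx.
by rewrite /GRing.comm => ->.
Qed.

Lemma mx_psd1 : mx_psd 1%:M.
Proof.
move=> v; rewrite mulmx1 mxE sumr_ge0// => i _.
by rewrite mxE -expr2 sqr_ge0.
Qed.

Lemma mx_psd_conj B (C : 'M[R]_n.+1) : mx_psd B -> mx_psd (C *m B *m C^T).
Proof. by move=> Bpsd v; have := Bpsd (v *m C); rewrite trmx_mul !mulmxA. Qed.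

Lemma mx_psdD A B : mx_psd A -> mx_psd B -> mx_psd (A + B).
Proof. by move=> hA hB v; rewrite mulmxDr mulmxDl mxE addr_ge0. Qed.

Lemma mx_psd_diag B i : mx_psd B -> 0 <= B i i.
Proof.
move=> /(_ (delta_mx 0 i)); rewrite -rowE trmx_delta -colE.
by rewrite !mxE.
Qed.

(** Extracting squares, which act by congruence, reduces both exponents to their parities. Matrix
    square roots are avoided by the identity used for ['X * (1 - 'X)]. *)
Lemma mx_psd_horner_mulX A : A^T = A -> mx_psd A -> mx_psd (1 - A) ->
  forall i j, mx_psd (horner_mx A ('X^i * (1 - 'X) ^+ j)).
Proof.
move=> symA psdA psdB i j.
have sq b p : mx_psd (horner_mx A b) -> mx_psd (horner_mx A (p * b * p)).
  move=> hb; rewrite !rmorphM /= -{2}(trmx_horner_mx p symA).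
  exact: mx_psd_conj.
have h0 : mx_psd (horner_mx A 1) by rewrite rmorph1; exact: mx_psd1.
have hX : mx_psd (horner_mx A 'X) by rewrite horner_mx_X.
have hY : mx_psd (horner_mx A (1 - 'X)) by rewrite rmorphB rmorph1 /= horner_mx_X.
have hXY : mx_psd (horner_mx A ('X * (1 - 'X))).
  have -> : 'X * (1 - 'X) = 'X * (1 - 'X) * 'X + (1 - 'X) * 'X * (1 - 'X) :> {poly R}.
    by ring.
  by rewrite rmorphD; apply: mx_psdD; exact: sq.
have -> : 'X^i * (1 - 'X) ^+ j = ('X ^+ i./2 * (1 - 'X) ^+ j./2) *
   ('X ^+ odd i * (1 - 'X) ^+ odd j) * ('X ^+ i./2 * (1 - 'X) ^+ j./2) :> {poly R}.
  rewrite -{1}(odd_double_half i) -{1}(odd_double_half j) !exprD -!addnn !exprD.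
  by ring.
apply: sq; case: (odd i); case: (odd j); rewrite ?expr0 ?expr1 ?mulr1 ?mul1r//.
Qed.

(** For symmetric [A], this is integration of [p] against the spectral measure of the first basis
    vector. *)
Definition mx_vacuum A p : R := horner_mx A p 0 0.

Lemma mx_vacuum_scalar A : scalar (mx_vacuum A).
Proof. by move=> c p q; rewrite /mx_vacuum linearP !mxE. Qed.

HB.instance Definition _ A := GRing.isLinear.Build R {poly R} R _ (mx_vacuum A)
  (@mx_vacuum_scalar A).

(** Schur's test: expand the nonnegative sum of [A i j * (v 0 i + e * v 0 j) ^+ 2] for [e = 1] or
    [e = -1]; by symmetry, the row sums bound both sums of pure squares. *)
Lemma mx_psd_norm A : A^T = A -> (forall i j, 0 <= A i j) ->
  (forall i, \sum_j A i j <= 1) -> mx_psd (1 + A) /\ mx_psd (1 - A).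
Proof.
move=> symA A0 A1.
have qf (e : R) v : (v *m (1 + e *: A) *m v^T) 0 0 =
    \sum_i v 0 i ^+ 2 + e * \sum_i \sum_j A i j * (v 0 i * v 0 j).
  rewrite mulmxDr mulmxDl mulmx1 -scalemxAr -scalemxAl !mxE; congr (_ + _ * _).
    by apply: eq_bigr => i _; rewrite mxE.
  rewrite exchange_big /=; apply: eq_bigr => i _; rewrite !mxE mulr_suml.
  by apply: eq_bigr => j _; ring.
have key (e : R) v : e ^+ 2 = 1 ->
    0 <= \sum_i v 0 i ^+ 2 + e * \sum_i \sum_j A i j * (v 0 i * v 0 j).
  move=> e1.
  have h1 : 0 <= \sum_i \sum_j A i j * (v 0 i + e * v 0 j) ^+ 2.
    by apply: sumr_ge0 => i _; apply: sumr_ge0 => j _; rewrite mulr_ge0// sqr_ge0.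
  have h2 : \sum_i \sum_j A i j * v 0 i ^+ 2 <= \sum_i v 0 i ^+ 2.
    apply: ler_sum => i _; by rewrite -mulr_suml ler_piMl ?sqr_ge0 ?A1.
  have h3 : \sum_i \sum_j A i j * v 0 j ^+ 2 <= \sum_i v 0 i ^+ 2.
    rewrite exchange_big /=; apply: ler_sum => i _; rewrite -mulr_suml.
    have -> : \sum_j A j i = \sum_j A i j.
      by apply: eq_bigr => j _; rewrite -{1}symA mxE.
    by rewrite ler_piMl ?sqr_ge0 ?A1.
  have h4 : \sum_i \sum_j A i j * (v 0 i + e * v 0 j) ^+ 2 =
      \sum_i \sum_j A i j * v 0 i ^+ 2 + \sum_i \sum_j A i j * v 0 j ^+ 2
      + 2 * (e * \sum_i \sum_j A i j * (v 0 i * v 0 j)).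
    rewrite !mulr_sumr -!big_split /=; apply: eq_bigr => i _.
    rewrite !mulr_sumr -!big_split /=; apply: eq_bigr => j _.
    by rewrite sqrrD exprMn e1 -mulr_natl; ring.
  lra.
split=> v; [have := qf 1 v | have := qf (-1) v].
  by rewrite scale1r => ->; apply: key; rewrite expr1n.
by rewrite scaleN1r => ->; apply: key; rewrite sqrrN expr1n.
Qed.

End SymmetricContraction.

(** * Jacobi matrices and Favard's theorem *)

Section JacobiMatrix.
Variables (R : realType) (a : nat -> R).
Hypotheses (a_ge0 : forall i, 0 <= a i) (a_le : forall i, 2 * a i <= 1).

Definition jacobi_mx n : 'M[R]_n.+1 :=
  \matrix_(i, j) ((i.+1 == j)%:R * a i + (j.+1 == i)%:R * a j).

Lemma jacobi_mx_sym n : (jacobi_mx n)^T = jacobi_mx n.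
Proof. by apply/matrixP => i j; rewrite !mxE addrC. Qed.

Lemma sum_ord_eq_le1 n (k : nat) : \sum_(j < n) (j == k :> nat)%:R <= 1 :> R.
Proof.
have [kn|nk] := ltnP k n.
  rewrite (bigD1 (Ordinal kn))//= eqxx big1 ?addr0// => j jk.
  by rewrite (_ : (j == k :> nat) = false)//; apply: contraNF jk => /eqP jk; apply/eqP/val_inj.
rewrite big1 ?ler01// => j _.
by rewrite ltn_eqF// (leq_trans (ltn_ord j)).
Qed.

Lemma jacobi_mx_psd n :
  mx_psd (1 + jacobi_mx n) /\ mx_psd (1 - jacobi_mx n).
Proof.
apply: mx_psd_norm => [|i j|i]; first exact: jacobi_mx_sym.
  by rewrite mxE addr_ge0 ?mulr_ge0.
have a2 k : a k <= 2^-1 by have := a_le k; lra.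
(* A row has at most two nonzero entries, each at most 1/2. For [i = 0], where [i.-1 = 0], the
   second term only enlarges the bound. *)
have : \sum_(j < n.+1) ((j == i.+1 :> nat)%:R / 2 + (j == i.-1 :> nat)%:R / 2)
    <= 1 :> R.
  rewrite big_split /= -!mulr_suml.
  have := sum_ord_eq_le1 n.+1 i.+1; have := sum_ord_eq_le1 n.+1 i.-1.
  lra.
apply: le_trans; apply: ler_sum => j _; rewrite mxE lerD//.
  by rewrite eq_sym ler_wpM2l.
have [<-|ji] := eqVneq j.+1 (nat_of_ord i); last by rewrite mul0r divr_ge0.
by rewrite eqxx !mul1r.
Qed.

Variables (A C kappa : nat -> R) (q : nat -> {poly R}).
Hypotheses (q0 : q 0%N = (kappa 0%N)%:P) (q1 : q 1%N = A 0%N *: ('X * q 0%N)).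
Hypothesis qS : forall n, q n.+2 = A n.+1 *: ('X * q n.+1) - C n *: q n.
Hypothesis kappaS : forall n, kappa n.+1 = A n * kappa n * a n.
Hypothesis kappaC : forall n, A n.+1 * kappa n.+1 * a n = C n * kappa n.

(** The first row of [q k] at the Jacobi matrix is [kappa k] times the [k]-th basis vector.
    Multiplication by ['X] spreads it to both neighbours: [kappaS] gives the upper coefficient,
    while [kappaC] cancels the lower one against [C n *: q n]. *)
Lemma jacobi_mx_row n k (j : 'I_n.+1) : (k <= n)%N ->
  horner_mx (jacobi_mx n) (q k) 0 j = kappa k * (k == j :> nat)%:R.
Proof.
have qX (p : {poly R}) i c : (i <= n)%N ->
    (forall j, horner_mx (jacobi_mx n) p 0 j = c * (i == j :> nat)%:R) ->
    forall j, horner_mx (jacobi_mx n) ('X * p) 0 j =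
      c * ((i.+1 == j)%:R * a i + (j.+1 == i)%:R * a j).
  move=> ik hp l; rewrite mulrC rmorphM /= horner_mx_X mxE.
  rewrite (bigD1 (Ordinal (ik : (i < n.+1)%N)))//= hp mxE eqxx mulr1 big1 ?addr0//.
  move=> l' ll'; rewrite hp [_ == _](_ : _ = false) ?mulr0 ?mul0r//.
  by apply: contraNF ll' => /eqP e; apply/eqP/val_inj.
have hZ c (p : {poly R}) l :
    horner_mx (jacobi_mx n) (c *: p) 0 l = c * horner_mx (jacobi_mx n) p 0 l.
  by rewrite linearZ /= mxE.
have hB (p r : {poly R}) l : horner_mx (jacobi_mx n) (p - r) 0 l =
    horner_mx (jacobi_mx n) p 0 l - horner_mx (jacobi_mx n) r 0 l.
  by rewrite linearB /= !mxE.
suff : (k <= n)%N ->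
    (forall j, horner_mx (jacobi_mx n) (q k) 0 j = kappa k * (k == j :> nat)%:R)
    /\ ((k < n)%N -> forall j,
      horner_mx (jacobi_mx n) (q k.+1) 0 j = kappa k.+1 * (k.+1 == j :> nat)%:R).
  by move=> /[apply] -[].
elim: k {j} => [|k IH] kn.
  have h0 (j : 'I_n.+1) : horner_mx (jacobi_mx n) (q 0%N) 0 j
      = kappa 0%N * (0%N == j :> nat)%:R.
    by rewrite q0 horner_mx_C mxE mulr_natr.
  split=> // n0 j; rewrite q1 hZ (qX _ _ _ _ h0)// kappaS.
  by rewrite [(j.+1 == 0)%N]/= mul0r addr0; ring.
have [h0 h1] := IH (ltnW kn); split; first exact: h1.
move=> kn' j; rewrite qS hB !hZ h0 (qX _ _ _ _ (h1 kn))// (kappaS k.+1) eqSS [j == k :> nat]eq_sym.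
rewrite mulrDr mulrDr -[RHS]addr0 -addrA; congr (_ + _); first by ring.
have [<-|_] := eqVneq k (nat_of_ord j); last by rewrite !mulr0 mul0r !mulr0 subrr.
by rewrite !mulr1 mul1r mulrA kappaC subrr.
Qed.

Lemma mx_vacuum_jacobi n i j : (i <= n)%N -> (j <= n)%N ->
  mx_vacuum (jacobi_mx n) (q i * q j) = kappa i * kappa j * (i == j)%:R.
Proof.
move=> hi hj; rewrite /mx_vacuum rmorphM /= mxE.
have sym k : horner_mx (jacobi_mx n) (q j) k 0 = horner_mx (jacobi_mx n) (q j) 0 k.
  by rewrite -{1}(trmx_horner_mx (q j) (jacobi_mx_sym n)) mxE.
under eq_bigr => k _ do rewrite sym !jacobi_mx_row//.
rewrite (bigD1 (Ordinal (hi : (i < n.+1)%N)))//= eqxx mulr1 big1 ?addr0.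
  by rewrite mulrA eq_sym.
move=> k ki; rewrite [i == k :> nat](_ : _ = false) ?mulr0 ?mul0r//.
by apply: contraNF ki => /eqP e; apply/eqP/val_inj.
Qed.

End JacobiMatrix.

(** The condition [4 * C n <= A n.+1 * A n] bounds the off-diagonal entries by 1/2, hence the Jacobi
    matrices by 1, uniformly in their size. *)
Theorem favard_chain_sequence (R : realType) (A C : nat -> R) (c : R)
    (q : nat -> {poly R}) :
  c != 0 -> (forall n, 0 < A n) -> (forall n, 0 < C n) ->
  (forall n, 4 * C n <= A n.+1 * A n) ->
  q 0%N = c%:P -> q 1%N = A 0%N *: ('X * q 0%N) ->
  (forall n, q n.+2 = A n.+1 *: ('X * q n.+1) - C n *: q n) ->
  orthogonal_polynomials q.
Proof.
move=> c0 A0 C0 AC q0 q1 qS.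
have AA0 n : 0 < A n.+1 * A n by rewrite mulr_gt0.
pose a n := Num.sqrt (C n / (A n.+1 * A n)).
have a2 n : a n ^+ 2 = C n / (A n.+1 * A n).
  by rewrite sqr_sqrtr// divr_ge0// ltW.
have a_gt0 n : 0 < a n by rewrite sqrtr_gt0 divr_gt0.
have a_ge0 n : 0 <= a n by exact: ltW.
have a_le n : 2 * a n <= 1.
  have : a n ^+ 2 <= 4^-1.
    by rewrite a2 ler_pdivrMr// mulrC ler_pdivlMr// mulrC.
  have := a_ge0 n; nra.
(* Up to the sign of [c], these are the norms of the [q n]: the integral of [q i * q j] will be
   [kappa i * kappa j] if [i = j], and 0 otherwise. *)
pose kappa := fix F n : R := if n is n'.+1 then A n' * F n' * a n' else c.
have kappa0 n : kappa n != 0.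
  by elim: n => //= n IH; rewrite !mulf_neq0// gt_eqF.
have kappaC n : A n.+1 * kappa n.+1 * a n = C n * kappa n.
  rewrite /= -/(kappa n).
  have -> : A n.+1 * (A n * kappa n * a n) * a n =
      a n ^+ 2 * (A n.+1 * A n) * kappa n by ring.
  by rewrite a2 divfK// gt_eqF.
have size_q : forall n, size (q n) = n.+1 /\ size (q n.+1) = n.+2.
  have sX (p : {poly R}) n k : size p = n.+1 -> size (A k *: ('X * p)) = n.+2.
    move=> sp; rewrite size_scale ?gt_eqF// mulrC size_mulX ?sp//.
    by rewrite -size_poly_eq0 sp.
  elim=> [|n [IH0 IH1]].
    by rewrite q1 (sX _ 0%N) q0 size_polyC c0.
  split=> //; rewrite qS size_polyDl ?(sX _ n.+1)//.
  by rewrite size_polyN (leq_ltn_trans (size_scale_leq _ _))// IH0.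
split=> [n|]; first by have [] := size_q n.
(* Hausdorff's theorem concerns [[0, 1]], so the spectrum is moved there from [[-1, 1]]; composing
   with [2 *: 'X - 1] undoes the shift. *)
pose T n := 2^-1 *: (1 + jacobi_mx a n).
have TJ n (p : {poly R}) : horner_mx (T n) (p \Po (2 *: 'X - 1)) = horner_mx (jacobi_mx a n) p.
  rewrite horner_mx_comp; congr (horner_mx _ p).
  rewrite rmorphB /= linearZ rmorph1 /= horner_mx_X scalerA divff ?pnatr_eq0//.
  by rewrite scale1r addrC addKr.
have T1 n : 1 - T n = 2^-1 *: (1 - jacobi_mx a n).
  apply/matrixP => i j; rewrite !mxE; lra.
have symT n : (T n)^T = T n by rewrite linearZ /= linearD /= tr_scalar_mx jacobi_mx_sym.
have psdZ n (B : 'M[R]_n.+1) : mx_psd B -> mx_psd (2^-1 *: B).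
  by move=> hB v; rewrite -scalemxAr -scalemxAl mxE mulr_ge0// invr_ge0.
have [||Q [Qm Q01 QL]] := @hausdorff_moment R (fun N => mx_vacuum (T N)).
- by move=> N; rewrite -[LHS]/(horner_mx (T N) 1 0 0) rmorph1 mxE eqxx.
- move=> N i j; apply: mx_psd_diag; have [h1 h2] := jacobi_mx_psd a_ge0 a_le N.
  by apply: mx_psd_horner_mulX => //; rewrite ?T1; exact: psdZ.
have [mu hmu] := horner_integral_quantile_measure Qm Q01.
have qq i j : (\int[mu]_x ((q i).[x] * (q j).[x])%:E = (kappa i * kappa j * (i == j)%:R)%:E)%E.
  under eq_integral do rewrite -hornerM.
  have [_ ->] := hmu (q i * q j); congr EFin; apply: QL.
  (* The value no longer depends on [N] once [N] exceeds both degrees. *)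
  apply: cvg_near_cst; near=> N.
  rewrite -[LHS]/(horner_mx (T N) ((q i * q j) \Po (2 *: 'X - 1)) 0 0) TJ.
  apply: (mx_vacuum_jacobi (kappa := kappa) q0 q1 qS (fun=> erefl) kappaC); near: N; exact: nbhs_infty_ge.
exists mu; split.
- by move=> n; have [+ _] := hmu 'X^n; under eq_fun do rewrite hornerXn.
- by move=> i j /eqP /negbTE ij; rewrite qq ij mulr0.
- move=> i; under eq_integral do rewrite expr2.
  by rewrite qq eqxx mulr1 lte_fin -expr2 exprn_even_gt0/=.
Unshelve. all: by end_near. Qed.

(** * Classical polynomials of low degree *)

Section Gbinom.
Variables (R : realType) (x : R).

Lemma gbinom0 : gbinom x 0 = 1.
Proof. by rewrite /gbinom big_ord0 divr1. Qed.

Lemma gbinomS k : gbinom x k.+1 = gbinom x k * (x - k%:R) / k.+1%:R.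
Proof.
rewrite /gbinom big_ord_recr /= factS natrM invfM; ring.
Qed.

End Gbinom.

Lemma horner_jacobi (R : realType) (a b : R) (n : nat) (y : R) :
  (jacobi a b n).[y] = \sum_(s < n.+1)
    gbinom (n%:R + a) s * gbinom (n%:R + b) (n - s) / 2 ^+ n
      * ((y - 1) ^+ (n - s) * (y + 1) ^+ s).
Proof.
by rewrite horner_sum; apply: eq_bigr => s _; rewrite !hornerE.
Qed.

Lemma horner_jacobi1 (R : realType) (a b y : R) :
  (jacobi a b 1).[y] = (a + b + 2) / 2 * y + (a - b) / 2.
Proof.
rewrite horner_jacobi !big_ord_recr big_ord0 /= !(gbinom0, gbinomS).
by field.
Qed.

Lemma horner_jacobi2 (R : realType) (a b y : R) :
  (jacobi a b 2).[y] = (a + b + 3) * (a + b + 4) / 8 * y ^+ 2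
    + (a - b) * (a + b + 3) / 4 * y + ((a - b) ^+ 2 - (a + b + 4)) / 8.
Proof.
rewrite horner_jacobi !big_ord_recr big_ord0 /= !(gbinom0, gbinomS).
by field.
Qed.

(** Equal parameters suffice from here on, since degrees 1 and 2 will force them. *)
Lemma horner_jacobi3 (R : realType) (a y : R) :
  (jacobi a a 3).[y] = (a + 2) * (a + 3) / 12
    * ((2 * a + 5) * y ^+ 3 - 3 * y).
Proof.
rewrite horner_jacobi !big_ord_recr big_ord0 /= !(gbinom0, gbinomS).
by field.
Qed.

Lemma horner_jacobi4 (R : realType) (a y : R) :
  (jacobi a a 4).[y] = (a + 3) * (a + 4) / 96 *
    ((2 * a + 5) * (2 * a + 7) * y ^+ 4 - 6 * (2 * a + 5) * y ^+ 2 + 3).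
Proof.
rewrite horner_jacobi !big_ord_recr big_ord0 /= !(gbinom0, gbinomS).
by field.
Qed.

Lemma horner_laguerre1 (R : realType) (a y : R) : (laguerre a 1).[y] = a + 1 - y.
Proof.
rewrite horner_poly !big_ord_recr big_ord0 /= !(gbinom0, gbinomS) !(factS, fact0).
by field.
Qed.

Lemma horner_laguerre2 (R : realType) (a y : R) :
  (laguerre a 2).[y] = (a + 1) * (a + 2) / 2 - (a + 2) * y + y ^+ 2 / 2.
Proof.
rewrite horner_poly !big_ord_recr big_ord0 /= !(gbinom0, gbinomS) !(factS, fact0).
by field.
Qed.

Lemma horner_hermite (R : realType) (n : nat) (y : R) :
  (hermite R n).[y] = \sum_(s < n./2.+1)
    (-1) ^+ s * n`!%:R / (s`!%:R * (n - 2 * s)`!%:R) * (2 * y) ^+ (n - 2 * s).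
Proof.
by rewrite horner_sum; apply: eq_bigr => s _; rewrite !hornerE.
Qed.

Lemma horner_hermite1 (R : realType) (y : R) : (hermite R 1).[y] = 2 * y.
Proof.
rewrite horner_hermite big_ord_recr big_ord0 /= !(factS, fact0).
by field.
Qed.

Lemma horner_hermite2 (R : realType) (y : R) :
  (hermite R 2).[y] = 4 * y ^+ 2 - 2.
Proof.
rewrite horner_hermite !big_ord_recr big_ord0 /= !(factS, fact0).
by field.
Qed.

Lemma horner_hermite3 (R : realType) (y : R) :
  (hermite R 3).[y] = 8 * y ^+ 3 - 12 * y.
Proof.
rewrite horner_hermite !big_ord_recr big_ord0 /= !(factS, fact0).
by field.
Qed.

(** * Affine rescalings compared in degrees up to 4 *)

Section LowDegreeComparison.
Variables (R : realType) (A C : nat -> R) (c : R) (q : nat -> {poly R}).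
Hypotheses (c0 : c != 0) (A0 : forall n, 0 < A n) (C0 : forall n, 0 < C n).
Hypotheses (q0 : q 0%N = c%:P) (q1 : q 1%N = A 0%N *: ('X * q 0%N)).
Hypothesis qS : forall n, q n.+2 = A n.+1 *: ('X * q n.+1) - C n *: q n.

Variable l : nat -> R.
Hypothesis lE : forall n, l n = C n / (A n.+1 * A n).

(** In [x = (y - b) / a], the monic forms of [q 2], [q 3], [q 4] are determined by [l]; here
    [t = a ^+ 2], and [K n] is the leading coefficient of [r n]. *)
Lemma affine_rescaling_low_degree (r : nat -> {poly R}) : affine_rescaling q r ->
  exists b t : R, 0 < t /\ exists K : nat -> R, (forall n, K n != 0) /\ forall y,
    [/\ (r 1%N).[y] = K 1%N * (y - b),
        (r 2%N).[y] = K 2%N * ((y - b) ^+ 2 - t * l 0%N),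
        (r 3%N).[y] = K 3%N * ((y - b) ^+ 3 - t * (l 0%N + l 1%N) * (y - b)) &
        (r 4%N).[y] = K 4%N * ((y - b) ^+ 4
          - t * (l 0%N + l 1%N + l 2%N) * (y - b) ^+ 2 + t ^+ 2 * l 0%N * l 2%N)].
Proof.
case=> a [b [a0 [d hd]]]; have d0 n : d n != 0 by have [] := hd n.
exists b, (a ^+ 2); split; first by rewrite exprn_even_gt0.
exists (fun n => c * (\prod_(i < n) A i) / (d n * a ^+ n)); split.
  move=> n; rewrite !mulf_neq0 ?invr_eq0 ?mulf_neq0 ?expf_neq0//.
  by apply/prodf_neq0 => i _; rewrite gt_eqF.
have rq n y : (r n).[y] = (q n).[(y - b) / a] / d n.
  have [_ ->] := hd n; rewrite hornerZ horner_comp hornerD hornerC hornerZ hornerX.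
  have -> : a * ((y - b) / a) + b = y by field.
  by rewrite mulrAC divff// mul1r.
have A_neq0 n : A n != 0 by rewrite gt_eqF.
move=> y; rewrite !rq !qS !q1 !q0 !hornerE !big_ord_recr big_ord0 /= !lE.
by split; field; rewrite ?a0 ?d0 ?A_neq0.
Qed.

(** The centre [b] would be [a + 1] by degree 1 and [a + 2] by degree 2. *)
Lemma laguerre_low_degree (a : R) : ~ affine_rescaling q (laguerre a).
Proof.
case/affine_rescaling_low_degree => b [t [t0 [K [K0 hr]]]].
have [+ + _ _] := hr 0; have [+ + _ _] := hr 1; have [+ + _ _] := hr (- 1).
rewrite !horner_laguerre1 !horner_laguerre2 => f1 f2 e1 e2 d1 d2.
have : K 1%N = - 1 by lra.
have : K 2%N = 2^-1 by lra.
by move=> k2 k1; rewrite k1 k2 in f1 f2 e1 e2 d1 d2; lra.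
Qed.

(** Degrees 2 and 3 give [t * l 0 = 1/2] and [t * (l 0 + l 1) = 3/2]. *)
Lemma hermite_low_degree : affine_rescaling q (@hermite R) -> l 1%N = 2 * l 0%N.
Proof.
case/affine_rescaling_low_degree => b [t [t0 [K [K0 hr]]]].
have [+ + _ _] := hr 0; have [+ + + _] := hr 1; have [_ _ + _] := hr 2.
rewrite !horner_hermite1 !horner_hermite2 !horner_hermite3.
move=> f3 e1 e2 e3 d1 d2.
have b0 : b = 0.
  have : K 1%N * b = 0 by lra.
  by move=> /eqP; rewrite mulf_eq0 (negbTE (K0 _)) => /eqP.
rewrite b0 !subr0 in f3 e1 e2 e3 d1 d2.
have k2 : K 2%N = 4 by lra.
have k3 : K 3%N = 8 by lra.
rewrite k2 k3 in f3 e1 e2 e3 d1 d2.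
have h : t * (l 1%N - 2 * l 0%N) = 0 by lra.
by apply/eqP; rewrite -subr_eq0; move/eqP: h; rewrite mulf_eq0 gt_eqF.
Qed.

Lemma jacobi_low_degree (a b : R) : -1 < a -> -1 < b ->
  affine_rescaling q (jacobi a b) ->
  l 2%N * (5 * l 0%N - l 1%N) = (l 0%N + l 1%N) ^+ 2.
Proof.
move=> a1 b1 /affine_rescaling_low_degree[e [t [t0 [K [K0 hr]]]]].
(* Degrees 1 and 2 give [(a + b + 2) * e = b - a = (a + b + 4) * e], whence [e = 0]. *)
have ab : a = b /\ e = 0.
  have [+ + _ _] := hr 0; have [+ + _ _] := hr 1; have [+ + _ _] := hr (- 1).
  rewrite !horner_jacobi1 !horner_jacobi2 => f1 f2 e1 e2 d1 d2.
  have k1 : K 1%N = (a + b + 2) / 2 by lra.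
  have k2 : K 2%N = (a + b + 3) * (a + b + 4) / 8 by lra.
  rewrite k1 k2 in f1 f2 e1 e2 d1 d2.
  have h1 : (a + b + 2) * e = b - a by lra.
  have h2 : (a + b + 3) * ((a + b + 4) * e - (b - a)) = 0 by lra.
  move/eqP: h2; rewrite mulf_eq0 gt_eqF /=; last by lra.
  move=> /eqP h2; have e0 : e = 0 by lra.
  by move: h1; rewrite e0; lra.
case: ab => ab e0; rewrite -{b b1}ab {e}e0 in hr.
have [_ d2 _ d4] := hr 0; have [_ e2 e3 e4] := hr 1.
have [_ _ f3 f4] := hr 2.
move: d2 d4 e2 e3 e4 f3 f4.
rewrite !horner_jacobi2 !horner_jacobi3 !horner_jacobi4 !subr0 subrr.
move=> d2 d4 e2 e3 e4 f3 f4.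
have k2 : K 2%N = (a + a + 3) * (a + a + 4) / 8 by lra.
have k3 : K 3%N = (a + 2) * (a + 3) / 12 * (2 * a + 5) by lra.
have k4 : K 4%N = (a + 3) * (a + 4) / 96 * ((2 * a + 5) * (2 * a + 7)) by lra.
rewrite {}k2 {}k3 {}k4 {K K0 hr} in d2 d4 e2 e3 e4 f3 f4.
have canc (x y z : R) : x != 0 -> x * y = x * z -> y = z by move=> x0; exact: mulfI.
have h0 : (2 * a + 3) * (t * l 0%N) = 1.
  by apply: (canc (a + 2)); [rewrite gt_eqF; lra|lra].
have h1 : (2 * a + 5) * (t * (l 0%N + l 1%N)) = 3.
  by apply: (canc ((a + 2) * (a + 3))); [rewrite gt_eqF ?mulr_gt0; lra|lra].
have h2 : (2 * a + 7) * (t * (l 0%N + l 1%N + l 2%N)) = 6.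
  by apply: (canc ((a + 3) * (a + 4) * (2 * a + 5))); [rewrite gt_eqF ?mulr_gt0; lra|lra].
have l0_gt0 : 0 < l 0%N by rewrite lE divr_gt0 ?mulr_gt0.
pose u n := t * l n; have u0_neq0 : u 0%N != 0 by rewrite gt_eqF ?mulr_gt0.
(* [E1] and [E2] eliminate [a]: by [h0], [(2 * a + 5) * u 0 = 1 + 2 * u 0] and
   [(2 * a + 7) * u 0 = 1 + 4 * u 0]. *)
have E1 : 2 * u 0%N * (u 0%N + u 1%N) = 2 * u 0%N - u 1%N.
  have : u 0%N * ((2 * a + 5) * (t * (l 0%N + l 1%N))) =
    (t * (l 0%N + l 1%N)) * ((2 * a + 3) * (t * l 0%N) + 2 * (t * l 0%N)).
    by rewrite /u; ring.
  by rewrite h0 h1 /u; lra.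
have E2 : u 2%N * (1 + 4 * u 0%N) = u 0%N + u 1%N.
  have : u 0%N * ((2 * a + 7) * (t * (l 0%N + l 1%N + l 2%N))) =
    (t * (l 0%N + l 1%N + l 2%N)) * ((2 * a + 3) * (t * l 0%N) + 4 * (t * l 0%N)).
    by rewrite /u; ring.
  by rewrite h0 h2; move: E1; rewrite /u; lra.
(* The goal is homogeneous of degree 2 in [l], so [t ^+ 2] turns it into one in [u]; the factor
   [2 * u 0] makes the left side of [E1] appear. *)
apply: (canc (2 * u 0%N * t ^+ 2)).
  by rewrite !mulf_neq0 ?pnatr_eq0 ?expf_neq0 ?gt_eqF.
transitivity (2 * u 0%N * (u 2%N * (5 * u 0%N - u 1%N))); first by rewrite /u; ring.
transitivity ((u 0%N + u 1%N) * (2 * u 0%N - u 1%N)); last first.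
  by rewrite -E1 /u; ring.
rewrite -E2 -mulrA.
transitivity (u 2%N * (2 * u 0%N * (u 0%N + u 1%N) + 8 * u 0%N ^+ 2 - 4 * u 0%N * u 1%N)).
  by ring.
by rewrite E1; ring.
Qed.

End LowDegreeComparison.

(** * The recurrence coefficients *)

Section RecurrenceCoefficients.
Variables (R : realType) (M : R).
Hypothesis M_ge2 : 2 <= M.

(** [rec_a n] comes from the recurrence at [k = 2n + 2] and [rec_c n] from [k = 2n + 4], after
    division by the leading factor. *)
Definition rec_a (n : nat) : R :=
  2 * ((2 * n%:R + 1) * M + 2) / ((2 * n%:R + 3) * M + 4).

Definition rec_c (n : nat) : R :=
  (2 * n%:R + 1) * M / ((2 * n%:R + 5) * M + 4).

(** The coefficients of the monic recurrence, numbered from 0: [rec_lambda n] is the coefficient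
    written [lambda_(n+1)] in the overview. *)
Definition rec_lambda (n : nat) : R := rec_c n / (rec_a n.+1 * rec_a n).

Let natM_ge0 n : 0 <= n%:R * M.
Proof. by rewrite mulr_ge0// (le_trans _ M_ge2). Qed.

Lemma rec_den_gt0 (n : nat) (j : R) : 0 <= j -> 0 < (2 * n%:R + j) * M + 4.
Proof.
move=> j0; have := natM_ge0 n; have : 0 <= j * M by rewrite mulr_ge0// (le_trans _ M_ge2).
lra.
Qed.

Lemma rec_a_gt0 n : 0 < rec_a n.
Proof. by rewrite divr_gt0 ?rec_den_gt0//; have := natM_ge0 n; move: M_ge2; lra. Qed.

Lemma rec_c_gt0 n : 0 < rec_c n.
Proof. by rewrite divr_gt0 ?rec_den_gt0//; have := natM_ge0 n; move: M_ge2; lra. Qed.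

Lemma rec_chain n : 4 * rec_c n <= rec_a n.+1 * rec_a n.
Proof.
have d3 : 0 < (2 * n%:R + 3) * M + 4 by exact: rec_den_gt0.
have d5 : 0 < (2 * n%:R + 5) * M + 4 by exact: rec_den_gt0.
have -> : rec_a n.+1 * rec_a n = 4 * rec_c n +
   16 * (M + 1) / (((2 * n%:R + 5) * M + 4) * ((2 * n%:R + 3) * M + 4)).
  rewrite /rec_a /rec_c -(natr1 n).
  have -> : (2 * (n%:R + 1) + 3) * M + 4 = (2 * n%:R + 5) * M + 4 by ring.
  by field; rewrite !gt_eqF.
by rewrite lerDl divr_ge0// ?ltW ?mulr_gt0//; move: M_ge2; lra.
Qed.

Let lambda0E : rec_lambda 0 = M * (3 * M + 4) / (4 * (3 * M + 2) * (M + 2)).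
Proof.
by rewrite /rec_lambda /rec_a /rec_c; field; rewrite !gt_eqF//; move: M_ge2; lra.
Qed.

Let lambda1E :
  rec_lambda 1 = 3 * M * (5 * M + 4) / (4 * (5 * M + 2) * (3 * M + 2)).
Proof.
by rewrite /rec_lambda /rec_a /rec_c; field; rewrite !gt_eqF//; move: M_ge2; lra.
Qed.

Let lambda2E :
  rec_lambda 2 = 5 * M * (7 * M + 4) / (4 * (7 * M + 2) * (5 * M + 2)).
Proof.
by rewrite /rec_lambda /rec_a /rec_c; field; rewrite !gt_eqF//; move: M_ge2; lra.
Qed.

Lemma rec_lambda_not_jacobi :
  rec_lambda 2 * (5 * rec_lambda 0 - rec_lambda 1)
    != (rec_lambda 0 + rec_lambda 1) ^+ 2.
Proof.
rewrite -subr_eq0 lambda0E lambda1E lambda2E; set d := _ - _.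
(* Over a common denominator, the defect is minus a polynomial in [M] with positive coefficients. *)
have -> : d = - (M ^+ 2 * (180 * M ^+ 4 + 1092 * M ^+ 3 + 1728 * M ^+ 2
     + 1008 * M + 192)
     / (4 * (7 * M + 2) * ((5 * M + 2) * (3 * M + 2) * (M + 2)) ^+ 2)).
  by rewrite /d; field; rewrite !gt_eqF//; move: M_ge2; lra.
have M0 : 0 < M by exact: lt_le_trans M_ge2.
have M2 := exprn_gt0 2 M0; have M3 := exprn_gt0 3 M0; have M4 := exprn_gt0 4 M0.
have num : 0 < 180 * M ^+ 4 + 1092 * M ^+ 3 + 1728 * M ^+ 2 + 1008 * M + 192.
  by lra.
have d2 : 0 < M + 2 by lra.
have d3 : 0 < 3 * M + 2 by lra.
have d5 : 0 < 5 * M + 2 by lra.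
have d7 : 0 < 4 * (7 * M + 2) by lra.
have den : 0 < 4 * (7 * M + 2) * ((5 * M + 2) * (3 * M + 2) * (M + 2)) ^+ 2.
  by apply: mulr_gt0 => //; apply: exprn_gt0; do 2 apply: mulr_gt0 => //.
rewrite oppr_eq0; exact: (lt0r_neq0 (divr_gt0 (mulr_gt0 M2 num) den)).
Qed.

Lemma rec_lambda_not_hermite : rec_lambda 1 != 2 * rec_lambda 0.
Proof.
rewrite -subr_eq0 lambda0E lambda1E; set d := _ - _.
have -> : d = - (M * (15 * M ^+ 2 + 10 * M - 8)
    / (4 * (5 * M + 2) * (3 * M + 2) * (M + 2))).
  by rewrite /d; field; rewrite !gt_eqF//; move: M_ge2; lra.
have M0 : 0 < M by exact: lt_le_trans M_ge2.
have num : 0 < 15 * M ^+ 2 + 10 * M - 8 by move: M_ge2; nra.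
have d2 : 0 < M + 2 by lra.
have d3 : 0 < 3 * M + 2 by lra.
have d5 : 0 < 4 * (5 * M + 2) by lra.
have den : 0 < 4 * (5 * M + 2) * (3 * M + 2) * (M + 2).
  by do 2 apply: mulr_gt0 => //.
rewrite oppr_eq0; exact: (lt0r_neq0 (divr_gt0 (mulr_gt0 M0 num) den)).
Qed.

End RecurrenceCoefficients.

(** * Passage to even indices and application of both criteria *)

Theorem corollary4p1 (R : realType) (m : nat) (hm : (2 <= m)%N)
  (P : nat -> {poly R})
  (hP0 : P 0%N = 1) (hP1 : P 1%N = 0) (hP2 : P 2%N = 0) (hP3 : P 3%N = 0)
  (hrec : forall k : nat,
    (k%:R * m%:R + m%:R + 4) *: P (k + 4)%N =
      (2 * ((k%:R - 1) * m%:R + 2)) *: ('X * P (k + 2)%N)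
      - ((k%:R - 3) * m%:R) *: P k) :
  orthogonal_polynomials (fun n => P (2 * n + 4)%N) /\
  ~ classical_polynomials (fun n => P (2 * n + 4)%N).
Proof.
move: hrec; set M : R := m%:R => hrec.
have M2 : 2 <= M by rewrite /M ler_nat.
have solve (x : R) (p r : {poly R}) : 0 < x -> x *: p = r -> p = x^-1 *: r.
  by move=> x0 <-; rewrite scalerA mulVf ?gt_eqF// scale1r.
have c0 : 3 * M / (M + 4) != 0 by rewrite gt_eqF// divr_gt0//; lra.
pose q n := P (2 * n + 4)%N; rewrite -/q.
have q0 : q 0%N = (3 * M / (M + 4))%:P.
  rewrite /q -[(2 * 0 + 4)%N]/(0 + 4)%N (solve _ _ _ _ (hrec 0%N)); last by lra.
  rewrite hP0 hP2 mulr0 scaler0 sub0r -scaleNr scalerA -[RHS]alg_polyC.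
  by congr (_ *: _); field; rewrite gt_eqF//; lra.
(* At [k = 2] the last term vanishes because [P 2 = 0], which gives the initial condition of
   Favard's theorem. *)
have q1 : q 1%N = rec_a M 0 *: ('X * q 0%N).
  clear q0.
  rewrite /q -[(2 * 1 + 4)%N]/(2 + 4)%N (solve _ _ _ _ (hrec 2%N)); last by lra.
  rewrite hP2 scaler0 subr0 scalerA; congr (_ *: _).
  by rewrite /rec_a; field; rewrite !gt_eqF//; lra.
have qS n : q n.+2 = rec_a M n.+1 *: ('X * q n.+1) - rec_c M n *: q n.
  rewrite /q; have -> : (2 * n.+2 + 4 = (2 * n + 4) + 4)%N by lia.
  have -> : (2 * n.+1 + 4 = (2 * n + 4) + 2)%N by lia.
  have := hrec (2 * n + 4)%N; rewrite natrD natrM.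
  have d5 : 0 < (2 * n%:R + 5) * M + 4 by exact: rec_den_gt0.
  have -> : (2 * n%:R + 4) * M + M + 4 = (2 * n%:R + 5) * M + 4 by ring.
  move=> /(solve _ _ _ d5) ->.
  rewrite scalerBr !scalerA /rec_a /rec_c -(natr1 n).
  have -> : (2 * (n%:R + 1) + 3) * M + 4 = (2 * n%:R + 5) * M + 4 by ring.
  by congr (_ *: _ - _ *: _); field; rewrite gt_eqF.
have A0 := rec_a_gt0 M2; have C0 := rec_c_gt0 M2.
split; first exact: (favard_chain_sequence c0 A0 C0 (rec_chain M2) q0 q1 qS).
have lE n : rec_lambda M n = rec_c M n / (rec_a M n.+1 * rec_a M n) by [].
case=> [[a [b [a1 b1 h]]]|[a _ h]|h].
- have /eqP := jacobi_low_degree c0 A0 C0 q0 q1 qS lE a1 b1 h.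
  by apply/negP/rec_lambda_not_jacobi.
- exact: (laguerre_low_degree c0 A0 q0 q1 qS lE h).
- have /eqP := hermite_low_degree c0 A0 q0 q1 qS lE h.
  by apply/negP/rec_lambda_not_hermite.
Qed.
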